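(* For any positive integers $r$ and $h$ and any real $\varepsilon>0$, there are infinitely many graphs $G$ that satisfy $iso(G\setminus S)\le \frac{1}{h}|S|$ for all $S\subseteq V(G)$, are $\big(\frac{5}{3}+\frac{1}{18r}-\varepsilon\big)$-tough, and have no connected $\{2,4,\ldots,2r\}$-factor.
   Context: Graphs are finite, have no loops, but may have multiple edges; degrees count multiplicities. For $S\subseteq V(G)$, $G\setminus S$ is the graph obtained by deleting $S$; $\omega(\cdot)$ is the number of connected components and $iso(\cdot)$ the number of isolated vertices. A graph is $t$-tough ($t>0$ real) if $\omega(G\setminus S)\le\max\{1,|S|/t\}$ for all $S\subseteq V(G)$. For a set $A$ of integers, an $A$-factor is a spanning subgraph all of whose vertex degrees lie in $A$. *)

(* Defs.v *)
From mathcomp Require Import all_boot.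
From Stdlib Require Import Reals.
Set Implicit Arguments.
Unset Strict Implicit.
Unset Printing Implicit Defensive.

(* A finite multigraph without loops on vertex type T is given by its
   edge-multiplicity function m : m x y = number of edges between x and y. *)
Definition is_multigraph (T : finType) (m : T -> T -> nat) : Prop :=
  (forall x y, m x y = m y x) /\ (forall x, m x x = 0%N).

Definition deg (T : finType) (m : T -> T -> nat) (x : T) : nat :=
  (\sum_(y : T) m x y)%N.

Definition adj_del (T : finType) (m : T -> T -> nat) (S : {set T}) : rel T :=
  fun x y => [&& x \notin S, y \notin S & (0 < m x y)%N].

Definition ncomp_del (T : finType) (m : T -> T -> nat) (S : {set T}) : nat :=
  n_comp (adj_del m S) (mem (~: S)).

Definition iso_del (T : finType) (m : T -> T -> nat) (S : {set T}) : nat :=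
  #|[set x | (x \notin S) && [forall y, (y \notin S) ==> (m x y == 0%N)]]|.

Definition tough (T : finType) (m : T -> T -> nat) (t : R) : Prop :=
  forall S : {set T},
    Rle (INR (ncomp_del m S)) (Rmax 1 (Rdiv (INR #|S|) t)).

Definition spanning_subgraph (T : finType) (m f : T -> T -> nat) : Prop :=
  (forall x y, f x y = f y x) /\ (forall x y, (f x y <= m x y)%N).

Definition connected_graph (T : finType) (f : T -> T -> nat) : Prop :=
  forall x y : T, connect (fun u v => (0 < f u v)%N) x y.

Definition even_upto (r : nat) (d : nat) : bool :=
  [&& ~~ odd d, (2 <= d)%N & (d <= 2 * r)%N].

Definition has_connected_even_factor (T : finType) (m : T -> T -> nat) (r : nat)
  : Prop :=
  exists f : T -> T -> nat,
    [/\ spanning_subgraph m f, connected_graph f &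
        forall x, even_upto r (deg f x)].

(* Main.v *)
Require Import Defs.
From mathcomp Require Import all_boot zify.
From Stdlib Require Import Reals Lra.

Set Implicit Arguments.
Unset Strict Implicit.
Unset Printing Implicit Defensive.

(* Take n copies of the Petersen graph sharing one common vertex 0, inflate
   every vertex to a large clique in which distinct Petersen edges end at
   distinct vertices, and join everything to a clique K on l vertices, where
   n = 2rl + 1.
   - A {2,4,...,2r}-factor has at most 2rl edges leaving K, so it misses some
     copy entirely.  There it uses an even number of the three edges at each
     inflated vertex; if it were connected, contracting the cliques would give
     a connected spanning even subgraph of the Petersen graph, that is, a
     Hamiltonian cycle.
   - To disconnect the graph one must delete K.  If this and s further
     deletions in one copy cut off c components from the clique of vertex 0,
     then 3-edge-connectivity gives 2s >= 3(c + 1), and c <= 9 yields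
     3s >= 5c.  Hence the toughness is about (l + 15n) / (9n + 1), which tends
     to 5/3 + 1/(18r) as l grows.
   - An isolated vertex of G - S needs the rest of its clique inside S. *)

(** * The Petersen graph: edge cuts and even subgraphs *)

Fixpoint bitseqs (n : nat) : seq bitseq :=
  if n is n'.+1 then
    [seq true :: b | b <- bitseqs n'] ++ [seq false :: b | b <- bitseqs n']
  else [:: [::]].

Lemma mem_bitseqs (b : bitseq) : b \in bitseqs (size b).
Proof.
elim: b => // -[] b IH; rewrite mem_cat; apply/orP; [left|right];
  exact: map_f.
Qed.

(** Outer cycle, spokes and inner pentagram, one per line. *)
Definition petersen_edges : seq (nat * nat) :=
  [:: (0, 1); (1, 2); (2, 3); (3, 4); (4, 0);
      (0, 5); (1, 6); (2, 7); (3, 8); (4, 9);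
      (5, 7); (7, 9); (9, 6); (6, 8); (8, 5)].

Definition petersen_adj (u v : nat) : bool := ((u, v) \in petersen_edges) || ((v, u) \in petersen_edges).

Lemma petersen_adjC u v : petersen_adj u v = petersen_adj v u.
Proof. exact: orbC. Qed.

Definition nbrs (u : nat) : seq nat :=
  [seq e.2 | e <- petersen_edges & e.1 == u] ++ [seq e.1 | e <- petersen_edges & e.2 == u].

Lemma mem_nbrs u v : (v \in nbrs u) = petersen_adj u v.
Proof.
rewrite mem_cat; congr orb; apply/mapP/idP => [[[a b]]|uv].
- by rewrite mem_filter => /andP[/eqP /= <-] + ->.
- by exists (u, v); rewrite ?mem_filter ?eqxx.
- by rewrite mem_filter => /andP[/eqP /= <-] + ->.
- by exists (v, u); rewrite ?mem_filter ?eqxx.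
Qed.

Lemma nbrs_uniq_lt (u : 'I_10) :
  uniq (nbrs u) && all (fun v => v < 10) (nbrs u).
Proof.
have chk : all (fun u => uniq (nbrs u) && all (fun v => v < 10) (nbrs u)) (iota 0 10).
  by vm_compute.
by apply: (allP chk); rewrite mem_iota ltn_ord.
Qed.

(** Bridge from sums over ordinals to lists on which finite checks can be computed. *)
Lemma sum_petersen_adj (u : 'I_10) (P : pred nat) :
  \sum_(v < 10) (petersen_adj u v && P v) = count P (nbrs u).
Proof.
rewrite -(big_mkord xpredT (fun v => nat_of_bool (petersen_adj u v && P v))).
rewrite (eq_bigr (fun v => if petersen_adj u v && P v then 1 else 0)); last by move=> v _; case: ifP.
rewrite -big_mkcond sum1_count -!size_filter; apply/perm_size/uniq_perm.
- by rewrite filter_uniq ?iota_uniq.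
- by have /andP[? _] := nbrs_uniq_lt u; rewrite filter_uniq.
move=> v; rewrite !mem_filter mem_nbrs mem_index_iota andbAC andbC.
case uv: (petersen_adj u v) => //=; rewrite [v < 10](_ : _ = true) ?andbT //.
by have /andP[_ /allP] := nbrs_uniq_lt u; apply; rewrite mem_nbrs.
Qed.

Definition cut_size (b : bitseq) : nat :=
  sumn [seq count (fun v => nth false b u && ~~ nth false b v) (nbrs u)
       | u <- iota 0 10].

(** 3-edge-connectivity, computed over all 1024 vertex sets; each cut edge is counted once, from its
    [true] side. *)
Lemma cut_size_ge3 :
  all (fun b => if all (pred1 true) b then true
                else if all (pred1 false) b then true else 3 <= cut_size b)
    (bitseqs 10).
Proof. by vm_compute. Qed.

Lemma petersen_cut (X : nat -> bool) (u0 v0 : 'I_10) :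
  X u0 -> ~~ X v0 ->
  3 <= \sum_(u < 10) \sum_(v < 10) [&& petersen_adj u v, X u & ~~ X v].
Proof.
move=> Xu Xv; pose b := mkseq X 10.
have Xb (u : 'I_10) : X u \in b by apply: map_f; rewrite mem_iota ltn_ord.
have nthb (u : 'I_10) : nth false b u = X u by rewrite nth_mkseq.
have := allP cut_size_ge3 b; rewrite -[10](size_mkseq X) mem_bitseqs => /(_ isT).
have -> : all (pred1 true) b = false.
  by apply/allPn; exists (X v0); rewrite //= (negbTE Xv).
have -> : all (pred1 false) b = false.
  by apply/allPn; exists (X u0); rewrite //= Xu.
move=> /leq_trans; apply; rewrite /cut_size sumnE big_map.
rewrite -[iota 0 10]/(index_iota 0 10) big_mkord; apply: leq_sum => u _.
rewrite -sum_petersen_adj; apply: leq_sum => v _; rewrite !nthb //.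
Qed.

Definition reach (s : seq (nat * nat)) : seq nat :=
  iter 9 (fun X => [seq v <- iota 0 10 |
    (v \in X) || has (fun u => ((u, v) \in s) || ((v, u) \in s)) X]) [:: 0].

(** Closure of [X] under [s] is tested explicitly, so the test is sound whatever set [reach]
    returns. *)
Definition disconnected (s : seq (nat * nat)) : bool :=
  let X := reach s in
  [&& 0 \in X, has (fun v => v \notin X) (iota 0 10) &
    all (fun e => (e.1 \in X) == (e.2 \in X)) s].

(* The cycle space of the Petersen graph has dimension 6; the six parameters
   below are the edges 01, 16, 27, 38, 49, 57. *)
Definition cycle_vector (a s1 s2 s3 s4 c : bool) : bitseq :=
  [:: a; a (+) s1; a (+) s1 (+) s2; a (+) s1 (+) s2 (+) s3;
      a (+) s1 (+) s2 (+) s3 (+) s4;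
      s1 (+) s2 (+) s3 (+) s4; s1; s2; s3; s4;
      c; c (+) s2; c (+) s2 (+) s4; c (+) s2 (+) s4 (+) s1;
      c (+) s2 (+) s4 (+) s1 (+) s3].

(** Non-Hamiltonicity of the Petersen graph: even subgraphs of a cubic graph have degrees 0 and 2,
    and all 64 of them are inspected. *)
Lemma cycle_vector_disconnected a s1 s2 s3 s4 c :
  disconnected (mask (cycle_vector a s1 s2 s3 s4 c) petersen_edges).
Proof. by case: a s1 s2 s3 s4 c => [] [] [] [] [] []; vm_compute. Qed.

(** Parity is asked only away from vertex 0, whose clique is shared by all copies; these nine
    equations imply the tenth. *)
Lemma petersen_no_connected_even (B : nat -> nat -> bool) :
  (forall u v, B u v = B v u) ->
  (forall u : 'I_10, u != ord0 -> ~~ odd (\sum_(v < 10) (petersen_adj u v && B u v))) ->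
  exists X : pred nat,
    [/\ X 0, exists v : 'I_10, ~~ X v &
        forall u v, petersen_adj u v -> B u v -> X u = X v].
Proof.
move=> symB evenB.
pose s := [seq e <- petersen_edges | B e.1 e.2].
have evB (u : nat) : 0 < u < 10 -> odd (count (B u) (nbrs u)) = false.
  case/andP=> u_gt0 u_lt10; have := evenB (Ordinal u_lt10).
  by rewrite sum_petersen_adj -val_eqE /= -lt0n => /(_ u_gt0) /negbTE.
have sE : s = mask (cycle_vector (B 0 1) (B 1 6) (B 2 7) (B 3 8) (B 4 9) (B 5 7)) petersen_edges.
  rewrite /s filter_mask /cycle_vector; congr mask => /=.
  (* The nine equations express the remaining nine edges through the six parameters. *)
  have := (evB 1 isT, evB 2 isT, evB 3 isT, evB 4 isT, evB 5 isT,
    evB 6 isT, evB 7 isT, evB 8 isT, evB 9 isT).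
  rewrite /= !addn0 !oddD !oddb.
  rewrite ?(symB 1 0, symB 2 1, symB 3 2, symB 4 3, symB 0 4, symB 5 0, symB 6 1,
    symB 7 2, symB 8 3, symB 9 4, symB 7 5, symB 9 7, symB 6 9, symB 8 6, symB 5 8).
  case=> [[[[[[[[e1 e2] e3] e4] e5] e6] e7] e8] e9].
  have addF x y : x (+) y = false -> x = y by case: x y => [] [].
  have e5' : B 0 5 = B 5 7 (+) B 8 5 by move: e5; case: (B 5 7) (B 0 5) (B 8 5) => [] [] [].
  rewrite e5' (addF _ _ e4) (addF _ _ e3) (addF _ _ e2) (addF _ _ e1).
  rewrite (addF _ _ e8) (addF _ _ e6) (addF _ _ e9) (addF _ _ e7).
  by case: (B 0 1) (B 1 6) (B 2 7) (B 3 8) (B 4 9) (B 5 7) => [] [] [] [] [] [].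
have : disconnected s by rewrite sE; apply: cycle_vector_disconnected.
rewrite /disconnected; move: (reach s) => X /and3P[X0 /hasP[v]].
rewrite mem_iota add0n => /andP[_ v_lt10] Xv /allP clX.
exists (fun v => v \in X); split=> //; first by exists (Ordinal v_lt10).
move=> u w /orP[] uw Buw; first by apply/eqP/(clX (u, w)); rewrite mem_filter Buw.
by apply/esym/eqP/(clX (w, u)); rewrite mem_filter /= symB Buw.
Qed.

(** If there are [q >= 2] label classes, each is left by at least 3 edges, so the sum over ordered
    pairs is at least [3 q]. *)
Lemma petersen_labelling (L : finType) (k : 'I_10 -> L) :
  10 * #|[set k u | u in 'I_10]|.-1 <=
  3 * \sum_(u < 10) \sum_(v < 10) (petersen_adj u v && (k u != k v)).
Proof.
set I := [set _ | _ in _].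
have I_le10 : #|I| <= 10 by rewrite -[X in _ <= X]card_ord leq_imset_card.
case: (leqP #|I| 1) => [|I_gt1]; first by case: #|I| => [|[]].
(* For [q = #|I| <= 10] one has [10 (q - 1) <= 9 q]. *)
suff : 3 * #|I| <= \sum_(u < 10) \sum_(v < 10) (petersen_adj u v && (k u != k v)) by lia.
have -> : \sum_(u < 10) \sum_(v < 10) (petersen_adj u v && (k u != k v)) =
  \sum_(y in I) \sum_(u < 10) \sum_(v < 10) [&& petersen_adj u v, k u == y & k v != y].
  rewrite [RHS]exchange_big; apply: eq_bigr => u _.
  rewrite [RHS]exchange_big; apply: eq_bigr => v _.
  rewrite (bigD1 (k u)) ?imset_f //= eqxx /= big1 ?addn0 ?(eq_sym (k v)) //.
  by move=> y /andP[_ /negPf]; rewrite eq_sym => ->; rewrite andbF.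
rewrite mulnC -sum_nat_const; apply: leq_sum => y yI.
have [z zI zy] : exists2 z, z \in I & z != y.
  have : 0 < #|I :\ y| by move: I_gt1; rewrite (cardsD1 y) yI.
  by case/card_gt0P => z; rewrite in_setD1 => /andP[? ?]; exists z.
have [/imsetP[u0 _ yE] /imsetP[v0 _ zE]] := (yI, zI).
have := @petersen_cut (fun n => k (inord n) == y) u0 v0.
rewrite !inord_val -yE -zE eqxx zy => /(_ isT isT) /leq_trans; apply.
by apply: leq_sum => u _; apply: leq_sum => v _; rewrite !inord_val.
Qed.

Lemma odd_sum_sym n (g : 'I_n -> 'I_n -> nat) :
  (forall a b, g a b = g b a) -> (forall a, g a a = 0) ->
  ~~ odd (\sum_(a < n) \sum_(b < n) g a b).
Proof.
move=> sg g0.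
have -> : \sum_(a < n) \sum_(b < n) g a b =
    \sum_(a < n) \sum_(b < n | a < b) g a b +
    \sum_(a < n) \sum_(b < n | b < a) g a b.
  rewrite -big_split; apply: eq_bigr => a _ /=.
  rewrite (bigID (fun b : 'I_n => a < b)) /=; congr addn.
  rewrite (bigD1 a) ?ltnn //= g0 add0n; apply: eq_bigl => b.
  by rewrite -leqNgt ltn_neqAle andbC.
rewrite [X in _ + X](exchange_big_dep xpredT) //= [X in _ + X](_ : _ =
  \sum_(a < n) \sum_(b < n | a < b) g a b) ?addnn ?odd_double //.
by apply: eq_bigr => a _; apply: eq_bigr => b _.
Qed.

(** * Isolated vertices and components in general multigraphs *)

Section MultigraphBounds.
Variables (T : finType) (m : T -> T -> nat) (S : {set T}).
Hypothesis mg : is_multigraph m.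

Lemma adj_del_sym : connect_sym (adj_del m S).
Proof.
by apply: sym_connect_sym => x y; rewrite /adj_del mg.1 andbCA.
Qed.

(** Double count pairs of an isolated [x] and a [y] in [S] of the same class. Each [x] has at least
    [h] partners; each [y] has at most one, since two isolated vertices of one class would be
    adjacent. *)
Lemma iso_del_clique_partition (C : eqType) (cl : T -> C) (h : nat) :
  (forall x y, cl x = cl y -> x != y -> 0 < m x y) ->
  (forall x, h < #|[set y | cl y == cl x]|) ->
  h * iso_del m S <= #|S|.
Proof.
move=> clq big; rewrite /iso_del; set I := [set x | _].
have inI x y : x \in I -> cl x = cl y -> x != y -> y \in S.
  rewrite inE => /andP[_ /forallP/(_ y)] iso cxy nxy.
  by apply: contraLR (clq _ _ cxy nxy) => yS; rewrite (eqP (implyP iso yS)).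
have IS x : x \in I -> x \notin S by rewrite inE => /andP[].
rewrite mulnC -sum_nat_const.
apply: (@leq_trans (\sum_(x in I) \sum_(y in S) (cl y == cl x))).
  apply: leq_sum => x xI; have := big x.
  rewrite (cardsD1 x) inE eqxx ltnS => /leq_trans; apply.
  rewrite -sum1_card big_mkcond [X in _ <= X]big_mkcond /=.
  apply: leq_sum => y _; rewrite !inE; case: eqVneq => //= nxy.
  by case: eqP => // cyx; rewrite (inI x) // eq_sym.
rewrite exchange_big -sum1_card; apply: leq_sum => y yS.
case: (boolP [exists x in I, cl y == cl x]) => [/existsP[x /andP[xI /eqP cyx]]|].
  rewrite (bigD1 x) //= big1 ?addn0 ?leq_b1 // => z /andP[zI nzx].
  case: eqP => // cyz; have := IS _ xI.
  by rewrite (inI z) // -cyz.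
rewrite negb_exists => /forallP nI; rewrite big1 // => x xI.
by have := nI x; rewrite xI /= => /negbTE ->.
Qed.

Lemma ncomp_del_dominating (x0 : T) :
  x0 \notin S -> (forall x, x0 != x -> 0 < m x0 x) -> ncomp_del m S <= 1.
Proof.
move=> x0S dom; rewrite /ncomp_del /n_comp_mem; apply/card_le1_eqP.
have rt x : x \in [predI roots (adj_del m S) & mem (~: S)] ->
    x = root (adj_del m S) x0.
  rewrite !inE => /andP[/eqP rx xS]; rewrite -[LHS]rx; apply/esym/rootP; first exact: adj_del_sym.
  case: (eqVneq x0 x) => [->|n0x]; first exact: connect0.
  by apply: connect1; rewrite /adj_del x0S xS dom.
by move=> x y /rt -> /rt ->.
Qed.

End MultigraphBounds.

(** * The inflated graph *)

Definition inflation_vertex (n h l : nat) : finType := ('I_n * 'I_10 * 'I_(10 + h) + 'I_l)%type.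

Lemma sum_inflation_vertex n h l (F : inflation_vertex n h l -> nat) :
  \sum_x F x =
  \sum_(i < n) \sum_(u < 10) \sum_(a < 10 + h) F (inl (i, u, a)) +
  \sum_(k < l) F (inr k).
Proof.
rewrite big_sumType /=; congr addn.
by rewrite [RHS]pair_bigA [RHS]pair_bigA; apply: eq_bigr => -[[i u] a].
Qed.

(* [inl (i, u, a)] is a vertex of the clique inflating vertex [u] of copy [i];
   its element [a = v] carries the Petersen edge towards [v].  The cliques of
   vertex 0 in all copies are merged into one; [inr] is the clique K. *)
Definition inflation_adj n h l (x y : inflation_vertex n h l) : bool :=
  match x, y with
  | inl (i, u, a), inl (j, v, b) =>
      if u == v then ((i == j) || (u == ord0)) && ((i, a) != (j, b))
      else [&& i == j, petersen_adj u v, a == v :> nat & b == u :> nat]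
  | _, _ => x != y
  end.

Definition inflation n h l (x y : inflation_vertex n h l) : nat := inflation_adj x y.

Lemma inflation_multigraph n h l : is_multigraph (@inflation n h l).
Proof.
split=> [x y|x]; rewrite /inflation; [congr nat_of_bool|apply/eqP; rewrite eqb0].
  case: x y => [[[i u] a]|k] [[[j v] b]|k'] //=; last by rewrite eq_sym.
  rewrite (eq_sym v) (eq_sym j) (eq_sym (j, b)) petersen_adjC.
  case: eqP => [->//|_]; congr andb; congr andb; exact: andbC.
by case: x => [[[i u] a]|k] /=; rewrite !eqxx ?andbF.
Qed.

Lemma inflation_iso n h l (S : {set inflation_vertex n h l}) :
  h < l -> h * iso_del (@inflation n h l) S <= #|S|.
Proof.
(* The merged clique of vertex 0 is split by copy; the class sizes [10 + h] and [l] all exceed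
   [h]. *)
move=> hl; apply: (@iso_del_clique_partition _ _ _ _
  (fun x : inflation_vertex n h l => if x is inl (i, u, _) then Some (i, u) else None)).
  case=> [[[i u] a]|k] [[[j v] b]|k'] //=; last by rewrite /inflation lt0b.
  case=> -> -> nab; rewrite /inflation lt0b /= !eqxx /=.
  by apply: contraNneq nab => -[->].
case=> [[[i u] a]|k].
  apply: (@leq_trans #|[set (inl (i, u, b) : inflation_vertex n h l) | b : 'I_(10 + h)]|).
    by rewrite card_imset ?card_ord; [lia | move=> b b' []].
  by apply/subset_leq_card/subsetP => _ /imsetP[b _ ->]; rewrite inE eqxx.
apply: (@leq_trans #|[set (inr k : inflation_vertex n h l) | k : 'I_l]|).
  by rewrite card_imset ?card_ord // => b b' [].
by apply/subset_leq_card/subsetP => _ /imsetP[b _ ->]; rewrite inE eqxx.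
Qed.

(** * Components after deleting all of [K] *)

Section Components.
Variables (n h l : nat) (S : {set inflation_vertex n h l}).
Hypothesis KS : forall k, inr k \in S.
Let e := adj_del (@inflation n h l) S.

Definition blob (i : 'I_n) (u : 'I_10) : {set inflation_vertex n h l} :=
  [set x | if x is inl (j, v, _) then (v == u) && ((i == j) || (u == ord0))
           else false].

Definition core : {set inflation_vertex n h l} :=
  [set x | if x is inl (_, v, _) then v == ord0 else false].

Definition root_label (A : {set inflation_vertex n h l}) : option (inflation_vertex n h l) :=
  omap (root e) [pick x in A :\: S].

(* Labels the inflated vertices of copy [i] by components of G - S; a fully
   deleted clique counts as part of the core, so that label changes occur only
   along Petersen edges with a deleted end. *)
Definition label (i : 'I_n) (u : 'I_10) : option (inflation_vertex n h l) :=
  if root_label (blob i u) is Some r then Some r else root_label core.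

Lemma root_blob i u x y :
  x \in blob i u -> y \in blob i u -> x \notin S -> y \notin S ->
  root e x = root e y.
Proof.
move=> xA yA xS yS; apply/rootP; first exact/adj_del_sym/inflation_multigraph.
case: (eqVneq x y) => [->|nxy]; first exact: connect0.
apply: connect1; rewrite /e /adj_del xS yS /inflation lt0b /=.
case: x y xA yA nxy {xS yS} => [[[i' u'] a]|k] [[[j v] b]|k']; rewrite !inE //=.
move=> /andP[/eqP -> hi] /andP[/eqP -> hj] nxy; rewrite eqxx.
apply/andP; split; last by apply: contraNneq nxy => -[-> ->].
by move: hi hj; case: (u == ord0); rewrite ?orbT ?orbF // => /eqP <- /eqP <-.
Qed.

Lemma label_root i u x :
  x \in blob i u -> x \notin S -> label i u = Some (root e x).
Proof.
move=> xA xS; rewrite /label /root_label; case: pickP => [y|/(_ x)] /=.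
  by rewrite inE => /andP[yS yA]; rewrite (root_blob yA xA).
by rewrite inE xS xA.
Qed.

Lemma label0 i : label i ord0 = root_label core.
Proof.
rewrite /label; have -> : blob i ord0 = core.
  by apply/setP => -[[[j v] b]|k]; rewrite !inE // eqxx orbT andbT.
by case: root_label.
Qed.

(** If both ends of the edge carrying [uv] survive, it connects the two cliques in G - S, so a
    change of label costs a deleted end. *)
Lemma label_edge i (u v : 'I_10) :
  petersen_adj u v && (label i u != label i v) <=
  (inl (i, u, lshift h v) \in S) + (inl (i, v, lshift h u) \in S).
Proof.
case: (boolP (inl _ \in S)) => [_|xS]; first exact: leq_trans (leq_b1 _) (leq_addr _ _).
case: (boolP (inl _ \in S)) => [_|yS]; first exact: leq_b1.
case uv: (petersen_adj u v) => //=; case: eqP => // nlab; case: nlab.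
have xb : inl (i, u, lshift h v) \in blob i u by rewrite inE !eqxx.
have yb : inl (i, v, lshift h u) \in blob i v by rewrite inE !eqxx.
rewrite (label_root xb xS) (label_root yb yS); congr Some.
apply/rootP; first exact/adj_del_sym/inflation_multigraph.
case: (eqVneq u v) => [->|nuv]; first exact: connect0.
by apply: connect1; rewrite /e /adj_del xS yS /inflation lt0b /= (negPf nuv) uv !eqxx.
Qed.

(** The core label always occurs, at [ord0]; the predecessor discounts it. *)
Definition extra_comps (i : 'I_n) : nat := #|[set label i u | u in 'I_10]|.-1.

Lemma extra_comps_le9 i : extra_comps i <= 9.
Proof.
rewrite /extra_comps; have : #|[set label i u | u in 'I_10]| <= 10.
  by rewrite -[X in _ <= X]card_ord leq_imset_card.
lia.
Qed.

(** As [K] is deleted, every component root is a label in some copy; the core label is common to all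
    copies and is counted once. *)
Lemma ncomp_extra_comps : ncomp_del (@inflation n h l) S <= 1 + \sum_i extra_comps i.
Proof.
pose A := [predI roots e & mem (~: S)].
rewrite -[ncomp_del _ _]/#|A| -(cardsE A) -(card_imset _ (@Some_inj _)).
apply: (@leq_trans #|root_label core |:
   \bigcup_i ([set label i u | u in 'I_10] :\ root_label core)|).
  apply/subset_leq_card/subsetP => _ /imsetP[x + ->].
  rewrite !inE => /andP[/eqP rx xS].
  case: eqVneq => //= nroot; apply/bigcupP.
  case: x rx xS nroot => [[[i u] a]|k] rx xS nroot; last by rewrite KS in xS.
  exists i => //; rewrite !inE nroot /=; apply/imsetP; exists u => //.
  by rewrite (@label_root i u (inl (i, u, a))) ?rx // inE !eqxx.
apply: leq_trans (leq_card_setU _ _) _; rewrite cards1 leq_add2l.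
elim/big_ind2: _ => [|A1 c1 A2 c2 H1 H2|i _]; first by rewrite cards0.
  by apply: leq_trans (leq_card_setU _ _) _; rewrite leq_add.
rewrite /extra_comps [X in _ <= X.-1](cardsD1 (root_label core)).
by rewrite [_ \in _](_ : _ = true) //; apply/imsetP; exists ord0 => //; rewrite label0.
Qed.

(** The deleted edge ends counted by [P] are distinct vertices of [S] outside [K]. Each is charged
    twice, by the ordered pairs [(u, v)] and [(v, u)], whence the factor 6 against 10. *)
Lemma extra_comps_card : 5 * \sum_i extra_comps i + 3 * l <= 3 * #|S|.
Proof.
pose P i (u v : 'I_10) : nat := inl (i, u, lshift h v) \in S.
have card_S : \sum_i \sum_u \sum_v P i u v + l <= #|S|.
  have -> : #|S| = \sum_x (x \in S).
    by rewrite -sum1_card big_mkcond; apply: eq_bigr => x _; case: ifP.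
  rewrite sum_inflation_vertex; apply: leq_add; last first.
    by under eq_bigr do rewrite KS; rewrite sum_nat_const card_ord muln1.
  apply: leq_sum => i _; apply: leq_sum => u _.
  by rewrite big_split_ord /= leq_addr.
have : 10 * \sum_i extra_comps i <= 6 * \sum_i \sum_u \sum_v P i u v.
  rewrite !big_distrr /=; apply: leq_sum => i _.
  apply: leq_trans (petersen_labelling _) _; rewrite -[X in _ <= X]/(3 * 2 * _) -mulnA leq_mul2l /=.
  rewrite mul2n -addnn [X in _ <= X + _]exchange_big -big_split /=.
  apply: leq_sum => u _; rewrite -big_split /=; apply: leq_sum => v _.
  by rewrite addnC label_edge.
lia.
Qed.

End Components.

Lemma inflation_ncomp n h l (S : {set inflation_vertex n h l}) :
  exists C, [/\ C <= 9 * n, ncomp_del (@inflation n h l) S <= 1 + C &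
    C = 0 \/ 5 * C + 3 * l <= 3 * #|S|].
Proof.
case: (boolP [exists k, inr k \notin S]) => [/existsP[k kS]|].
  (* A surviving vertex of [K] is adjacent to all others. *)
  exists 0; split; [by [] | | by left].
  apply: ncomp_del_dominating kS _; first exact: inflation_multigraph.
  by case=> [[[j v] b]|k'] nk; rewrite /inflation lt0b.
rewrite negb_exists => /forallP KS.
have {}KS k : inr k \in S by apply/negPn.
exists (\sum_i extra_comps S i); split; last by right; exact: extra_comps_card.
  rewrite mulnC -[X in _ <= X * _](card_ord n) -sum_nat_const.
  by apply: leq_sum => i _; exact: extra_comps_le9.
exact: ncomp_extra_comps.
Qed.

(** * Absence of a connected even factor *)

Section NoFactor.
Variables (n h l r : nat) (F : inflation_vertex n h l -> inflation_vertex n h l -> nat).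
Hypothesis F_le : forall x y, F x y <= inflation x y.
Hypothesis F_sym : forall x y, F x y = F y x.
Hypothesis F_even : forall x, even_upto r (deg F x).

(** Degrees in [K] are at most [2 * r]. Vertices of the merged clique keep their copy index, so an
    edge from [K] to them touches only that copy. *)
Lemma untouched_copy :
  2 * r * l < n ->
  exists i : 'I_n, forall k u a, F (inr k) (inl (i, u, a)) = 0.
Proof.
move=> ln; pose tot (i : 'I_n) := \sum_k \sum_u \sum_a F (inr k) (inl (i, u, a)).
case: (boolP [exists i, tot i == 0]) => [/existsP[i]|].
  rewrite sum_nat_eq0 => /forallP t0; exists i => k u a.
  have := t0 k; rewrite /= sum_nat_eq0 => /forallP/(_ u).
  by rewrite /= sum_nat_eq0 => /forallP/(_ a) /eqP.
rewrite negb_exists => /forallP tpos.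
have : n <= \sum_i tot i.
  rewrite -[X in X <= _](card_ord n) -sum1_card; apply: leq_sum => i _.
  by rewrite lt0n.
rewrite /tot exchange_big /=.
have : \sum_k \sum_i \sum_u \sum_a F (inr k) (inl (i, u, a)) <= \sum_(k < l) 2 * r.
  apply: leq_sum => k _; have /and3P[_ _] := F_even (inr k).
  by apply: leq_trans; rewrite /deg sum_inflation_vertex leq_addr.
rewrite sum_nat_const card_ord => H1 H2; have := leq_trans H2 H1.
by rewrite leqNgt (mulnC l) ln.
Qed.

Variable i : 'I_n.
Hypothesis untouched : forall k u a, F (inr k) (inl (i, u, a)) = 0.

Definition port (u v : nat) : inflation_vertex n h l := inl (i, inord u, lshift h (inord v)).

Definition used (u v : nat) : bool := 0 < F (port u v) (port v u).

Lemma petersen_irrefl (u : 'I_10) : petersen_adj u u = false.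
Proof. by case: u; do 10 case=> //. Qed.

Lemma used_even (u : 'I_10) :
  u != ord0 -> ~~ odd (\sum_(v < 10) (petersen_adj u v && used u v)).
Proof.
move=> u0; pose G (v : 'I_10) (a b : 'I_(10 + h)) := F (inl (i, u, a)) (inl (i, v, b)).
have degE a : deg F (inl (i, u, a)) = \sum_(v < 10) \sum_(b < 10 + h) G v a b.
  rewrite /deg sum_inflation_vertex [X in _ + X]big1 ?addn0 => [|k _]; last by rewrite F_sym.
  rewrite (bigD1 i) //= [X in _ + X]big1 ?addn0 // => j nji.
  rewrite big1 // => v _; rewrite big1 // => b _; apply/eqP.
  rewrite -leqn0 (leq_trans (F_le _ _)) // /inflation leqn0 eqb0 /=.
  by rewrite (negPf u0) orbF [i == j]eq_sym (negPf nji) /= if_same.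
have crossE (v : 'I_10) : u != v ->
    \sum_(a < 10 + h) \sum_(b < 10 + h) G v a b = (petersen_adj u v && used u v).
  move=> nuv.
  have G0 (a b : 'I_(10 + h)) : ~~ [&& petersen_adj u v, a == v :> nat & b == u :> nat] -> G v a b = 0.
    move=> nad; apply/eqP; rewrite -leqn0 (leq_trans (F_le _ _)) //.
    by rewrite /inflation leqn0 eqb0 /= (negPf nuv) eqxx.
  rewrite (bigD1 (lshift h v)) //= [X in _ + X]big1 => [|a nav]; last first.
    rewrite big1 // => b _; apply: G0; apply: contra nav => /and3P[_ /eqP av _].
    by apply/eqP/val_inj.
  rewrite (bigD1 (lshift h u)) //= big1 => [|b nbu]; last first.
    apply: G0; apply: contra nbu => /and3P[_ _ /eqP av].
    by apply/eqP/val_inj.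
  rewrite !addn0 /used /port !inord_val -/(G v (lshift h v) (lshift h u)).
  (* Multiplicity at most 1 makes [F] agree with the boolean [used]. *)
  have : G v (lshift h v) (lshift h u) <= 1 by exact: leq_trans (F_le _ _) (leq_b1 _).
  case uv: (petersen_adj u v) => /=; last by rewrite G0 ?uv.
  by case: (G v _ _) => [|[]].
have : ~~ odd (\sum_(a < 10 + h) deg F (inl (i, u, a))).
  elim/big_ind: _ => // [x y|a _]; first by rewrite oddD => /negPf-> /negPf->.
  by have /and3P[] := F_even (inl (i, u, a)).
under eq_bigr do rewrite degE.
rewrite exchange_big (bigD1 u) //= oddD.
rewrite (negPf (odd_sum_sym _ _)) => [||a]; last 2 first.
- by move=> a b; exact: F_sym.
- by apply/eqP; rewrite -leqn0 (leq_trans (F_le _ _)) // /inflation leqn0 eqb0 /= !eqxx andbF.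
rewrite [X in _ -> ~~ odd X](bigD1 u) //= petersen_irrefl add0n.
by under eq_bigr => v nvu do rewrite crossE 1?eq_sym //.
Qed.

Lemma not_connected : ~ connected_graph F.
Proof.
move=> conF.
have used_sym u v : used u v = used v u by rewrite /used F_sym.
have [X [X0 [v0 Xv0] clX]] := petersen_no_connected_even used_sym used_even.
(* [Y] is the side of copy [i] away from vertex 0. As [X 0] holds, it avoids the merged clique, so
   [F] could leave it only through [K] or a used Petersen edge across [X]. *)
pose Y (x : inflation_vertex n h l) := if x is inl (j, w, _) then (j == i) && ~~ X w else false.
have clY : closed (fun x y => 0 < F x y) Y.
  apply: intro_closed; first by apply: sym_connect_sym => x y; rewrite F_sym.
  move=> x y Fxy; have := leq_trans Fxy (F_le x y); rewrite /inflation lt0b.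
  case: x y Fxy => [[[j w] a]|k] [[[j' w'] b]|k'] //; rewrite /in_mem /= => Fxy; last first.
    by move=> _ /andP[/eqP ij _]; rewrite F_sym ij untouched in Fxy.
  have nX0 : ~~ X w -> w != ord0 by apply: contraNneq => ->.
  case: eqVneq => [<-|nww] + /andP[/eqP ji Xw].
    by rewrite (negPf (nX0 Xw)) orbF -ji => /andP[/eqP <- _]; rewrite eqxx.
  rewrite -ji => /and4P[/eqP jj pww /eqP aw /eqP bw]; rewrite -jj eqxx /=.
  rewrite -(clX w w') // /used /port !inord_val -ji.
  have -> : lshift h w' = a by exact: val_inj.
  have -> : lshift h w = b by exact: val_inj.
  by rewrite -jj in Fxy.
have := closed_connect clY (conF (port v0 0) (port 0 0)).
rewrite /in_mem /= !inord_val eqxx Xv0.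
by rewrite inordK // X0.
Qed.

End NoFactor.

(** * Toughness arithmetic and choice of parameters *)

Lemma ratio_bound (r l c s eps : R) :
  (1 <= r -> 2 <= l -> 1 <= l * eps -> 0 <= c <= 9 * (2 * r * l + 1) ->
   5 * c + 3 * l <= 3 * s -> 0 < 5 / 3 + 1 / (18 * r) - eps ->
   1 + c <= s / (5 / 3 + 1 / (18 * r) - eps))%R.
Proof.
move=> r_ge1 l_ge2 leps [c_ge0 c_le] cs t_gt0.
apply: (Rmult_le_reg_r _ _ _ t_gt0).
rewrite /Rdiv [X in Rle _ X]Rmult_assoc Rinv_l ?Rmult_1_r; last lra.
set d := Rmult 1 (Rinv _).
have rd : (r * d = 1 / 18)%R by rewrite /d; field; lra.
have d_gt0 : (0 < d)%R by nra.
have d_le : (d <= 1 / 18)%R by nra.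
(* Since [s >= l + 5 c / 3], only the excess [d - eps] over [5 / 3] must be paid for by [l]. *)
suff : ((d - eps) * (1 + c) <= l - 5 / 3)%R by rewrite -/d in t_gt0 *; lra.
case: (Rle_lt_dec (d - eps) 0) => [d_le0|d_gt_eps]; first by nra.
have : ((d - eps) * (1 + c) <= (d - eps) * (18 * r * l + 10))%R.
  by apply: Rmult_le_compat_l; lra.
have -> : ((d - eps) * (18 * r * l + 10) =
    18 * (r * d) * l + 10 * d - 18 * r * (l * eps) - 10 * eps)%R by ring.
(* By [l * eps >= 1] and [r >= 1], the right side is at most [l + 10 / 18 - 18]. *)
rewrite rd; nra.
Qed.

(** Infinitude is expressed by graphs of arbitrarily large size; the upper bound on [eps] makes the
    toughness parameter positive. *)
Theorem mainTheorem20 (r h : nat) (eps : R) :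
  (0 < r)%N -> (0 < h)%N -> Rlt 0 eps ->
  Rlt eps (Rplus (Rdiv 5 3) (Rdiv 1 (Rmult 18 (INR r)))) ->
  forall N : nat,
    exists (T : finType) (m : T -> T -> nat),
      [/\ is_multigraph m,
          (N <= #|T| + \sum_(x : T) deg m x)%N,
          (forall S : {set T},
              Rle (INR (iso_del m S)) (Rdiv (INR #|S|) (INR h))),
          tough m (Rminus (Rplus (Rdiv 5 3) (Rdiv 1 (Rmult 18 (INR r)))) eps) &
          ~ has_connected_even_factor m r].
Proof.
move=> r_gt0 h_gt0 eps_gt0 eps_lt N.
have [l0 l0_large] := INR_unbounded (/ eps).
(* The summands of [l] serve [l * eps >= 1], [h < l], the size [N] and [l >= 2]; [n] exceeds by one
   the number of copies that [K] can touch. *)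
pose l := (l0 + h + N + 2)%N; pose n := (2 * r * l).+1.
have INR_le a b : (a <= b)%N -> Rle (INR a) (INR b) by move/leP; exact: le_INR.
have r_ge1 : Rle 1 (INR r) by exact: (INR_le 1).
have h_ge1 : Rle 1 (INR h) by exact: (INR_le 1).
exists (inflation_vertex n h l), (@inflation n h l); split.
- exact: inflation_multigraph.
- apply: leq_trans (leq_addr _ _).
  by rewrite card_sum [#|'I_l|]card_ord /l; lia.
- move=> S; have /INR_le := @inflation_iso n h l S ltac:(rewrite /l; lia).
  rewrite mult_INR => H; apply: (Rmult_le_reg_l (INR h)); first lra.
  by rewrite /Rdiv -Rmult_assoc Rinv_r_simpl_m; lra.
- move=> S; set t := Rminus _ _.
  have t_gt0 : Rlt 0 t by rewrite /t; lra.
  have [C [C_le comp_le C_card]] := inflation_ncomp S.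
  apply: Rle_trans (INR_le _ _ comp_le) _; rewrite plus_INR /=.
  case: C_card => [->|C_card] /=; first by rewrite Rplus_0_r; exact: Rmax_l.
  apply: Rle_trans (Rmax_r _ _).
  apply: (@ratio_bound _ (INR l)) => //.
  + by apply: (INR_le 2); rewrite /l; lia.
  + have l0_le : Rle (INR l0) (INR l) by apply: INR_le; rewrite /l; lia.
    apply: (Rmult_le_reg_r (/ eps)); first exact: Rinv_0_lt_compat.
    by rewrite Rmult_assoc Rinv_r; lra.
  + split; first exact: pos_INR.
    have nE : INR n = (2 * INR r * INR l + 1)%R by rewrite /n S_INR !mult_INR.
    by have := INR_le _ _ C_le; rewrite mult_INR nE /=; lra.
  + by have := INR_le _ _ C_card; rewrite plus_INR !mult_INR /=; lra.
case=> F [[F_sym F_le] F_con F_even].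
have [|i Hi] := untouched_copy (n := n) F_even; first by rewrite /n.
by apply: (not_connected F_le F_sym F_even Hi).
Qed.
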